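(* Let $p\in(0,1]$ and let $\mathcal{V}$ be a finite vocabulary. Then the algorithm PRAKA with parameter $p$ achieves $\epsilon$-differential privacy with $\epsilon = 2\ln\frac{2-p}{p}$. That is, for every word $w\in\mathcal{V}$, for any two possible values $B_1,B_2\in\{[1,0],[0,1]\}$ of the user's true array $B$ for $w$, and for every set $R\subseteq\{0,1\}^2$ of possible randomized arrays, $$\Pr(B'\in R\mid B=B_1)\ \le\ e^{\epsilon}\,\Pr(B'\in R\mid B=B_2),\qquad \epsilon=2\ln\frac{2-p}{p},$$ where $B'$ is the randomized array that PRAKA reports for $w$.
   Context: PRAKA (privacy-preserving randomized keyword aggregation) is a randomized algorithm run on behalf of a single user, who has designated each word of a finite vocabulary $\mathcal{V}$ as either sensitive or not sensitive. It has a parameter $p$ (a probability). For each word $w\in\mathcal{V}$ it does the following. (1) Create a 2-bit array $B=[b_1,b_2]$ initialized to $[0,0]$. (2) If the user sets $w$ as sensitive, set $b_1=1$; otherwise set $b_2=1$. Thus $B=[1,0]$ if $w$ is sensitive for the user and $B=[0,1]$ otherwise. (3) For each bit $i\in\{1,2\}$, independently: with probability $\frac{p}{2}$ set the bit to $1$, with probability $\frac{p}{2}$ set it to $0$, and with probability $1-p$ leave it unmodified. Call the resulting array $B'=[b_1',b_2']$. (4) Report the pair $\langle w,B'\rangle$ to a central server. Exactly one report is made for each $w$. Differential privacy here is local and concerns the report for a word: the private input is the user's true array $B$ for that word (which encodes whether the user regards the word as sensitive), any two possible inputs are considered neighbouring, and the output is the randomized array $B'$. The word $w$ itself is not private, since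 a report is made for every $w\in\mathcal{V}$. *)

(* Defs.v *)
From mathcomp Require Import all_boot all_order all_algebra.
From mathcomp Require Import reals sequences exp.

Set Implicit Arguments.
Unset Strict Implicit.
Unset Printing Implicit Defensive.

Import Order.TTheory GRing.Theory Num.Theory.
Local Open Scope ring_scope.

(* A finite distribution is given by its probability mass function; that the
   functions used below are nonnegative and sum to 1 is proved at the end. *)
Section Distributions.
Variables (R : realType) (A B : finType).

Definition Pr (mu : {ffun A -> R}) (E : {set A}) : R := \sum_(a in E) mu a.

Definition law (mu : {ffun A -> R}) (f : A -> B) : {ffun B -> R} :=
  [ffun b => \sum_(a | f a == b) mu a].

End Distributions.

(* M x is the distribution of the output on the private input x; any two
   inputs of D are neighbouring. *)
Definition local_dp (R : realType) (X A : finType) (D : {set X})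
    (M : X -> {ffun A -> R}) (eps : R) : Prop :=
  forall x1 x2 : X, x1 \in D -> x2 \in D ->
  forall E : {set A}, Pr (M x1) E <= expR eps * Pr (M x2) E.

Definition bits : finType := 2.-tuple bool.

Definition set_bit (B : bits) (i : 'I_2) (b : bool) : bits :=
  [tuple if j == i then b else tnth B j | j < 2].

(* S is the set of words that the user designates as sensitive. *)
Definition true_array (V : finType) (S : {set V}) (w : V) : bits :=
  let B := [tuple false; false] in
  if w \in S then set_bit B ord0 true else set_bit B ord_max true.

Definition possible_arrays (V : finType) (w : V) : {set bits} :=
  [set true_array S w | S : {set V}].

(* The random choice made for one bit: Some b sets the bit to b, and None
   leaves it unmodified. *)
Definition choice_pmf (R : realType) (p : R) (c : option bool) : R :=
  if c is Some _ then p / 2 else 1 - p.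

(* The product expresses that the two bits are treated independently. *)
Definition choices_pmf (R : realType) (p : R) :
    {ffun {ffun 'I_2 -> option bool} -> R} :=
  [ffun c : {ffun 'I_2 -> option bool} => \prod_(i < 2) choice_pmf p (c i)].

Definition randomize (B : bits) (c : {ffun 'I_2 -> option bool}) : bits :=
  [tuple odflt (tnth B i) (c i) | i < 2].

Definition praka_report (R : realType) (V : finType) (p : R) (w : V)
    (B : bits) : {ffun V * bits -> R} :=
  law (choices_pmf p)
    (fun c : {ffun 'I_2 -> option bool} => (w, randomize B c)).

Definition praka_array (R : realType) (V : finType) (p : R) (w : V)
    (B : bits) : {ffun bits -> R} :=
  law (praka_report p w B) snd.

Lemma possible_arraysE (V : finType) (w : V) :
  possible_arrays w = [set [tuple true; false]; [tuple false; true]].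
Proof.
have E1 : set_bit [tuple false; false] ord0 true = [tuple true; false].
  by apply: eq_from_tnth => -[[|[|i]] hi] //; rewrite tnth_mktuple.
have E2 : set_bit [tuple false; false] ord_max true = [tuple false; true].
  by apply: eq_from_tnth => -[[|[|i]] hi] //; rewrite tnth_mktuple.
apply/setP => B; rewrite !inE; apply/imsetP/orP.
  by move=> [S _ ->]; rewrite /true_array; case: ifP => _; rewrite ?E1 ?E2 eqxx;
    [left | right].
case=> /eqP ->.
  by exists [set: V] => //; rewrite /true_array inE E1.
by exists set0 => //; rewrite /true_array inE E2.
Qed.

Lemma law_ge0 (R : realType) (A B : finType) (mu : {ffun A -> R}) (f : A -> B) :
  (forall a, 0 <= mu a) -> forall b, 0 <= law mu f b.
Proof. by move=> mu0 b; rewrite ffunE sumr_ge0. Qed.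

Lemma law_sum (R : realType) (A B : finType) (mu : {ffun A -> R}) (f : A -> B) :
  \sum_b law mu f b = \sum_a mu a.
Proof.
by rewrite [RHS](partition_big f predT) //=; apply: eq_bigr => b _; rewrite ffunE.
Qed.

Lemma praka_array_ge0 (R : realType) (V : finType) (p : R) (w : V) (B B' : bits) :
  0 <= p <= 1 -> 0 <= praka_array p w B B'.
Proof.
move=> /andP[p0 p1]; do 2 apply: law_ge0 => ?.
rewrite ffunE prodr_ge0 // => i _; rewrite /choice_pmf.
by case: (_ i) => [_|]; rewrite ?divr_ge0 ?subr_ge0.
Qed.

Lemma praka_array_sum (R : realType) (V : finType) (p : R) (w : V) (B : bits) :
  \sum_B' praka_array p w B B' = 1.
Proof.
rewrite !law_sum; under eq_bigr do rewrite ffunE.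
rewrite -(bigA_distr_bigA (fun (_ : 'I_2) c => choice_pmf p c)).
apply: big1 => i _.
rewrite (bigD1 None) //= (bigD1 (Some true)) //= (bigD1 (Some false)) //= big1.
  by rewrite addr0 -splitr subrK.
by move=> [[]|].
Qed.

(* Main.v *)
(* The two bits are randomized independently, so the mass of B' given B is a
   product over the bits of factors 1 - p / 2 (bit kept) or p / 2 (bit
   flipped). Changing B multiplies each factor by at most (2 - p) / p, and
   there are two factors. *)

Require Import Defs.
From mathcomp Require Import all_boot all_order all_algebra.
From mathcomp Require Import reals sequences exp.
From mathcomp Require Import ring lra.

Import Order.TTheory GRing.Theory Num.Theory.
Local Open Scope ring_scope.

Lemma law_comp (R : realType) (A B C : finType) (mu : {ffun A -> R})
    (f : A -> B) (g : B -> C) : law (law mu f) g = law mu (g \o f).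
Proof.
apply/ffunP => c; rewrite !ffunE.
rewrite [RHS](partition_big f (fun b => g b == c)) //=.
apply: eq_bigr => b /eqP gb; rewrite ffunE; apply: eq_bigl => a.
by case: (f a =P b) => [->|]; rewrite ?gb ?eqxx ?andbF.
Qed.

(** The outcome [b'] arises from [Some b'], of mass [p / 2], and also from [None], of mass [1 - p],
    exactly when [b == b']. *)
Lemma sum_choice_pmf (R : realType) (p : R) (b b' : bool) :
  \sum_(o | odflt b o == b') choice_pmf p o =
  if b == b' then 1 - p / 2 else p / 2.
Proof.
rewrite big_mkcond (bigD1 None) //= (bigD1 (Some true)) //=.
rewrite (bigD1 (Some false)) //= big1; last by move=> [[]|].
by case: b b' => -[] /=; lra.
Qed.

Lemma praka_arrayE (R : realType) (V : finType) (p : R) (w : V) (B B' : bits) :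
  praka_array p w B B' =
  \prod_(i < 2) if tnth B i == tnth B' i then 1 - p / 2 else p / 2.
Proof.
(* Each factor becomes a sum over one bit's choices; distributing the product over these sums gives
   a sum over the [c] with [randomize B c = B']. *)
under eq_bigr do rewrite -sum_choice_pmf.
rewrite bigA_distr_big_dep /praka_array /praka_report law_comp ffunE /=.
under eq_bigr do rewrite ffunE.
apply: eq_bigl => c; apply/eqP/familyP => [<- i|H].
  by rewrite tnth_mktuple unfold_in.
apply: eq_from_tnth => i; rewrite tnth_mktuple; exact/eqP/H.
Qed.

Lemma praka_array_ratio (R : realType) (V : finType) (p : R) (w : V)
    (B1 B2 B' : bits) : 0 < p -> p <= 1 ->
  praka_array p w B1 B' <= ((2 - p) / p) ^+ 2 * praka_array p w B2 B'.
Proof.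
move=> p0 p1; rewrite !praka_arrayE.
rewrite -[X in _ ^+ X](card_ord 2) -prodr_const -big_split /=.
have rp : (2 - p) / p * (p / 2) = 1 - p / 2 by field; rewrite gt_eqF.
have r1 : 1 <= (2 - p) / p by rewrite ler_pdivlMr //; lra.
(* A bit kept from [B1] but flipped from [B2] gives equality, by [rp]; the other cases follow from
   [r1] and [p / 2 <= 1 - p / 2]. *)
by apply: ler_prod => i _; do 2 case: ifP => _; rewrite ?rp; apply/andP; split; nra.
Qed.

Theorem theorem1 (R : realType) (V : finType) (p : R)
    (p_gt0 : 0 < p) (p_le1 : p <= 1) (w : V) :
  local_dp (possible_arrays w) (praka_array p w) (2 * ln ((2 - p) / p)).
Proof.
move=> B1 B2 _ _ E.
have r0 : 0 < (2 - p) / p by rewrite divr_gt0 //; lra.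
(* The exponential is the square of the ratio, so the pointwise bound can be summed over [E]. *)
rewrite expRM_natl lnK ?posrE // /Pr mulr_sumr.
by apply: ler_sum => B' _; apply: praka_array_ratio.
Qed.
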